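(* Let $\Lambda$ be a hereditary QF-$3^{+}$ ring. (a) For any module $M$, $\mathbf{R}(I(M))=I(\mathbf{R}(M))$ (i.e. the submodule $\mathbf{R}(I(M))$ of $I(M)$ is the injective envelope of $\mathbf{R}(M)$). (b) If $I$ is an injective module, then so is $\mathbf{R}(I)$.
   Context: Rings are associative with identity; modules are left unital $\Lambda$-modules. A ring $\Lambda$ is left QF-$3^{+}$ if the injective envelope of the left module ${}_\Lambda\Lambda$ is projective; a left hereditary left QF-$3^{+}$ ring is also right hereditary and right QF-$3^{+}$, so one speaks of hereditary QF-$3^{+}$ rings. $I(M)$ denotes the injective envelope of $M$. A module is stable if it has no nonzero projective direct summands; $\mathbf{R}(M)$ is the largest stable submodule of $M$ (it exists for every $M$ when $\Lambda$ is left hereditary). *)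

(* Defs.v *)
From HB Require Import structures.
From mathcomp Require Import all_boot all_algebra.
From mathcomp Require Import boolp.

Set Implicit Arguments.
Unset Strict Implicit.
Unset Printing Implicit Defensive.

Import GRing.Theory.
Local Open Scope ring_scope.

(* A ring is a [pzRingType]: associative, unital, not assumed commutative and
   possibly zero.  A left unital module is an [lmodType R].  A submodule of [M]
   is a [submodClosed M]; its membership predicate is boolean, which is no
   restriction classically. *)

Section Submodules.
Variables (R : pzRingType) (M : lmodType R).

Definition submod (N : submodClosed M) : Type := {x : M | x \in N}.

Section Instances.
Variable N : submodClosed M.
HB.instance Definition _ := [isSub of submod N for @sval M (fun x => x \in N)].
HB.instance Definition _ := [Choice of submod N by <:].
HB.instance Definition _ := [SubChoice_isSubLmodule of submod N by <:].
End Instances.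

Definition zero_submod : {pred M} := pred1 0.

Fact zero_submod_closed : submod_closed zero_submod.
Proof.
split=> [|a x y]; first exact: eqxx.
by rewrite !inE => /eqP -> /eqP ->; rewrite scaler0 addr0.
Qed.

HB.instance Definition _ :=
  GRing.isSubmodClosed.Build R M zero_submod zero_submod_closed.

Definition nonzero_submod (N : submodClosed M) : Prop :=
  exists2 x : M, x \in N & x != 0.

Definition direct_summand (N : submodClosed M) : Prop :=
  exists K : submodClosed M,
    (forall x : M, x \in N -> x \in K -> x = 0) /\
    (forall x : M, exists y z : M, [/\ y \in N, z \in K & x = y + z]).

End Submodules.

Section HomologicalNotions.
Variable R : pzRingType.

Definition projective (P : lmodType R) : Prop :=
  forall (A B : lmodType R) (g : {linear A -> B}) (f : {linear P -> B}),
    (forall b : B, exists a : A, g a = b) ->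
    exists h : {linear P -> A}, forall x : P, g (h x) = f x.

Definition injective_module (E : lmodType R) : Prop :=
  forall (A B : lmodType R) (g : {linear A -> B}) (f : {linear A -> E}),
    injective g ->
    exists h : {linear B -> E}, forall x : A, h (g x) = f x.

Definition essential_mono (M E : lmodType R) (i : {linear M -> E}) : Prop :=
  injective i /\
  forall N : submodClosed E, nonzero_submod N ->
    exists2 x : M, x != 0 & i x \in N.

Definition injective_envelope (M E : lmodType R) (i : {linear M -> E}) : Prop :=
  injective_module E /\ essential_mono i.

Definition stable (M : lmodType R) : Prop :=
  forall N : submodClosed M,
    direct_summand N -> projective (submod N) -> ~ nonzero_submod N.

Definition largest_stable_submod (M : lmodType R) (N : submodClosed M) : Prop :=
  stable (submod N) /\
  forall N' : submodClosed M, stable (submod N') -> {subset N' <= N}.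

(* The largest stable submodule, as a definite description; the value is the
   zero submodule if there is none, which does not happen over a left
   hereditary ring. *)
Definition stable_part (M : lmodType R) : submodClosed M :=
  match pselect (exists N : submodClosed M, largest_stable_submod N) with
  | left ex => projT1 (cid ex)
  | right _ => @zero_submod R M
  end.

End HomologicalNotions.

(* The left ideals of [R] are the submodules of the regular left module [R^o]. *)
Definition left_hereditary (R : pzRingType) : Prop :=
  forall J : submodClosed R^o, projective (submod J).

Definition left_QF3plus (R : pzRingType) : Prop :=
  exists (E : lmodType R) (i : {linear R^o -> E}),
    injective_envelope i /\ projective E.

(* Main.v *)
From HB Require Import structures.
Require Import Defs.
From mathcomp Require Import all_boot all_algebra.
From mathcomp Require Import boolp classical_sets functions.

Set Implicit Arguments.
Unset Strict Implicit.
Unset Printing Implicit Defensive.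

Import GRing.Theory.
Local Open Scope ring_scope.

(** Over a left hereditary ring a module is stable iff it has no nonzero
    homomorphism to [R]: the image of such a map is a left ideal, hence
    projective, hence splits off.  If moreover [E(R)] is projective, then
    [E(R)] is cogenerated by [R], and the injectivity of [E(R)] shows that the
    intersection of the kernels of all maps [M -> R] is itself stable; so it
    equals R(M).  A map to [R] that vanishes on an essential submodule is zero,
    because its image splits; hence a map [B -> I] that sends an essential
    submodule into R(I) has its whole image in R(I).  This gives the
    injectivity of R(I) when [I] is injective, by extending a map [A -> R(I)]
    by zero on a complement of [A] in [B] before extending it to [B -> I]. *)

(** * Building linear maps and submodules from plain functions and predicates *)

Lemma linear_pack (R : pzRingType) (U V : lmodType R) (f : U -> V) :
  linear f -> exists h : {linear U -> V}, h =1 f.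
Proof.
move=> lin_f.
pose b := GRing.isLinear.Build R U V *:%R f lin_f.
pose h : {linear U -> V} := HB.pack f b.
by exists h.
Qed.

Lemma submod_pack (R : pzRingType) (M : lmodType R) (P : M -> Prop) :
  P 0 -> (forall a x y, P x -> P y -> P (a *: x + y)) ->
  exists N : submodClosed M, forall x, x \in N <-> P x.
Proof.
move=> P0 PD.
pose S : {pred M} := fun x => `[< P x >].
have SP x : x \in S <-> P x by split=> /asboolP.
have S_closed : submod_closed S.
  by split=> [|a x y /SP Px /SP Py]; apply/SP; [|exact: PD].
pose b := GRing.isSubmodClosed.Build R M S S_closed.
pose N : submodClosed M := HB.pack S b.
by exists N.
Qed.

Lemma submod_oppr_closed (R : pzRingType) (M : lmodType R)
    (N : submodClosed M) : GRing.oppr_closed N.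
Proof. by move=> x xN; rewrite -scaleN1r rpredZ. Qed.

Lemma submod_subr_closed (R : pzRingType) (M : lmodType R)
    (N : submodClosed M) : GRing.subr_closed N.
Proof. by move=> x y xN yN; rewrite rpredD // submod_oppr_closed. Qed.

Lemma corestrict (R : pzRingType) (U M : lmodType R) (N : submodClosed M)
    (f : {linear U -> M}) :
  (forall x, f x \in N) ->
  exists h : {linear U -> submod N}, forall x, \val (h x) = f x.
Proof.
move=> fN.
have lin : linear (fun x => Sub (f x) (fN x) : submod N).
  by move=> a x y; apply: val_inj; rewrite [RHS]linearP !SubK linearP.
have [h hE] := linear_pack lin.
by exists h => x; rewrite hE SubK.
Qed.

(** * Projective modules are cogenerated by the ring *)

Section Projective.
Variable R : pzRingType.

Lemma projective_retract (P Q : lmodType R) (g : {linear P -> Q})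
    (s : {linear Q -> P}) :
  cancel g s -> projective Q -> projective P.
Proof.
move=> gK projQ A B p f p_surj.
have [h hE] := projQ A B p (f \o s) p_surj.
by exists (h \o g) => x; rewrite /= hE /= gK.
Qed.

(* The pairs satisfying [combination] form the graph of the canonical surjection
   onto [P] from the free module on [P]: [u.1] is a finitely supported family of
   coefficients.  Working in the graph makes that surjection a projection. *)
Let combination (P : lmodType R) (u : (P -> R^o) * P) : Prop :=
  exists s : seq P, [/\ uniq s, forall p, p \notin s -> u.1 p = 0 &
    u.2 = \sum_(p <- s) (u.1 p : R) *: p].

(** Padding with zero terms brings two families to a common list, so that they can be added. *)
Let combination_on (P : lmodType R) (u : (P -> R^o) * P) (s t : seq P) :
  uniq s -> (forall p, p \notin s -> u.1 p = 0) ->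
  u.2 = \sum_(p <- s) (u.1 p : R) *: p ->
  uniq t -> {subset s <= t} ->
  u.2 = \sum_(p <- t) (u.1 p : R) *: p.
Proof.
move=> Us u0 -> Ut st.
rewrite [RHS](bigID (mem s)) /= [X in _ = _ + X]big1.
  rewrite addr0 -[RHS]big_filter; apply: perm_big; apply: uniq_perm => //.
    exact: filter_uniq.
  by move=> p; rewrite mem_filter /=; case: (boolP (p \in s)) => // /st ->.
by move=> p /u0 ->; rewrite scale0r.
Qed.

(** Projectivity splits the canonical surjection. Each coordinate of the splitting is a map to [R],
    so if all maps vanish at [x], then [x] is a combination with zero coefficients. *)
Lemma projective_cogenerated (P : lmodType R) (x : P) :
  projective P -> (forall f : {linear P -> R^o}, f x = 0) -> x = 0.
Proof.
move=> projP f0.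
have [||F FP] := @submod_pack R ((P -> R^o) * P)%type (@combination P).
- by exists [::]; split=> //; rewrite big_nil.
- move=> a u v [s [Us u0 us]] [t [Ut v0 vt]].
  pose w := undup (s ++ t).
  have Uw : uniq w by exact: undup_uniq.
  have sw : {subset s <= w} by move=> p ps; rewrite mem_undup mem_cat ps.
  have tw : {subset t <= w} by move=> p pt; rewrite mem_undup mem_cat pt orbT.
  exists w; split=> //.
    move=> p; rewrite mem_undup mem_cat negb_or => /andP[ps pt].
    have -> : (a *: u + v).1 p = a *: u.1 p + v.1 p by [].
    by rewrite u0 // v0 // scaler0 addr0.
  have -> : (a *: u + v).2 = a *: u.2 + v.2 by [].
  rewrite (combination_on Us u0 us Uw sw) (combination_on Ut v0 vt Uw tw).
  rewrite scaler_sumr -big_split; apply: eq_bigr => p _ /=.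
  by rewrite scalerA -scalerDl.
have [g gE] : exists g : {linear submod F -> P}, forall u, g u = (\val u).2.
  by apply: linear_pack => a u v; rewrite linearP.
have [|h hK] := projP _ _ g (idfun : {linear P -> P}).
  move=> p; pose d : (P -> R^o) * P := (fun q => (q == p)%:R, p).
  have pF : d \in F.
    apply/FP; exists [:: p]; split=> //=.
      by move=> q; rewrite inE => /negPf ->.
    by rewrite big_seq1 eqxx scale1r.
  by exists (exist (fun u => u \in F) d pF); rewrite gE.
have /FP [s [_ _ xs]] : \val (h x) \in F by exact: valP.
rewrite -[x]/(idfun x) -hK gE xs big1 // => p _.
have [f fE] : exists f : {linear P -> R^o}, forall y, f y = (\val (h y)).1 p.
  by apply: linear_pack => a y z; rewrite !linearP.
by rewrite -fE f0 scale0r.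
Qed.

End Projective.

(** * Complements with essential sum *)

Section Complement.
Variables (R : pzRingType) (B : lmodType R).

Lemma complement_exists (A : submodClosed B) :
  exists K : submodClosed B,
    (forall x, x \in A -> x \in K -> x = 0) /\
    (forall N : submodClosed B, nonzero_submod N ->
       exists a k, [/\ a \in A, k \in K, a + k \in N & a + k != 0]).
Proof.
(* [P] does not require [0] in [X], because the union of the empty chain is empty; [K] adds [0]
   back. *)
pose P (X : set B) := (forall a x y, X x -> X y -> X (a *: x + y)) /\
  forall x, x \in A -> X x -> x = 0.
have [|X [[XD XA] Xmax]] := @Zorn_bigcup B P.
  move=> F FP Ftot; split=> [a x y [X FX Xx] [Y FY Yy]|x xA [X FX Xx]].
    have [XY|YX] := Ftot _ _ FX FY.
      by exists Y => //; apply: (FP _ FY).1 => //; exact: XY.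
    by exists X => //; apply: (FP _ FX).1 => //; exact: YX.
  exact: (FP _ FX).2.
have [||K KP] := @submod_pack R B (fun x => x = 0 \/ X x).
- by left.
- move=> a x y [->|Xx] [->|Xy].
  + by left; rewrite scaler0 addr0.
  + by right; rewrite scaler0 add0r.
  + right; have X0 : X 0 by rewrite -(addNr x) -scaleN1r; exact: XD.
    exact: XD.
  + by right; exact: XD.
have KA x : x \in A -> x \in K -> x = 0.
  by move=> xA /KP [//|]; exact: XA.
exists K; split=> // N [n nN n0].
(* [L] is [K + N]. If it meets [A] in some nonzero [x = k + n], then [n = x - k] is the required
   element; otherwise maximality puts [N] inside [K]. *)
have [||L LP] := @submod_pack R B (fun x => exists2 k, k \in K & x - k \in N).
- by exists 0; rewrite ?subr0 rpred0.
- move=> a x y [k kK xk] [l lK yl]; exists (a *: k + l).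
    by rewrite rpredD // rpredZ.
  rewrite opprD addrACA -scalerN -scalerDr.
  by rewrite rpredD // rpredZ.
have [[x xA [xL x0]]|LA] := pselect (exists2 x, x \in A & x \in L /\ x <> 0).
  have /LP [k kK xk] := xL; exists x, (- k); split=> //.
    by rewrite submod_oppr_closed.
  apply/eqP => /subr0_eq xk0; apply: x0; apply: KA => //.
  by rewrite xk0.
have XL : forall x, x \in L -> X x.
  move=> x xL; apply: contrapT => Xx; apply: (Xmax (fun x => x \in L)).
    split=> [y Xy|LX]; last by apply: Xx; exact: LX.
    by apply/LP; exists y; [apply/KP; right|rewrite subrr rpred0].
  split=> [a y z yL zL|y yA yL]; first by rewrite rpredD // rpredZ.
  by apply: contrapT => y0; apply: LA; exists y.
exists 0, n; rewrite add0r rpred0; split=> //; apply/KP; right; apply: XL.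
by apply/LP; exists 0; rewrite ?rpred0 ?subr0.
Qed.

End Complement.

(** * Stability and maps to the ring, over a left hereditary ring *)

Section Hereditary.
Variable R : pzRingType.
Hypothesis hered : left_hereditary R.

(** [J] is the image of [f]; as a left ideal it is projective, so [f] splits onto it. *)
Lemma image_splits (M : lmodType R) (f : {linear M -> R^o}) :
  exists (J : submodClosed R^o) (s : {linear submod J -> M}),
    (forall x, f x \in J) /\ (forall y, f (s y) = \val y).
Proof.
have [||J JP] := @submod_pack R R^o (fun y => exists x, f x = y).
- by exists 0; rewrite linear0.
- by move=> a _ _ [x <-] [y <-]; exists (a *: x + y); rewrite linearP.
have fJ x : f x \in J by apply/JP; exists x.
have [g gE] := corestrict fJ.
have [|s sK] := @hered J _ _ g (idfun : {linear submod J -> submod J}).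
  move=> y; have /JP[x xy] : \val y \in J by exact: valP.
  by exists x; apply: val_inj; rewrite gE.
by exists J, s; split=> // y; rewrite -gE sK.
Qed.

Lemma stableP (M : lmodType R) :
  stable M <-> forall (f : {linear M -> R^o}) (x : M), f x = 0.
Proof.
split=> [stM f x|hom0 N [K [NK NKM]] projN [y yN y0]].
  have [J [s [fJ sK]]] := image_splits f.
  have [||N NP] := @submod_pack R M (fun x => exists y, s y = x).
  - by exists 0; rewrite linear0.
  - by move=> a _ _ [y <-] [z <-]; exists (a *: y + z); rewrite linearP.
  have [||K KP] := @submod_pack R M (fun x => f x = 0).
  - exact: linear0.
  - by move=> a y z fy fz; rewrite linearP fy fz scaler0 addr0.
  have [h hE] := corestrict fJ.
  have sN y : s y \in N by apply/NP; exists y.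
  have fs0 y : f (s y) = 0 -> s y = 0.
    by rewrite sK => y0; have -> : y = 0 by [apply: val_inj]; rewrite linear0.
  (* The image [N] of the section is a complement of the kernel [K] of [f]. *)
  have sumN : direct_summand N.
    exists K; split=> [y /NP[z <-] /KP|y]; first exact: fs0.
    exists (s (h y)), (y - s (h y)); split=> //; last by rewrite addrC subrK.
    by apply/KP; rewrite linearB sK hE subrr.
  have [s' s'E] := corestrict sN.
  have projN : projective (submod N).
    apply: (@projective_retract R _ _ (h \o val) s'); last exact: hered.
    move=> y; apply: val_inj; rewrite s'E /=.
    have /NP[z zy] : \val y \in N by exact: valP.
    by rewrite -zy; congr (s _); apply: val_inj; rewrite hE sK.
  apply: contrapT => fx0; apply: (stM N sumN projN).
  exists (s (h x)) => //; apply/eqP => shx; apply: fx0.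
  by rewrite -hE -sK shx linear0.
(* [p] is the projection onto [N] along [K]. Composed with it, any map from [N] to [R] extends to
   [M] and hence vanishes, so the projective module [N] is zero. *)
have /choice[p pP] : forall x, exists z, z \in N /\ x - z \in K.
  by move=> x; have [z [k [zN kK ->]]] := NKM x; exists z; rewrite addrC addKr.
have p_uniq x z : z \in N -> x - z \in K -> p x = z.
  move=> zN xz; apply/eqP; rewrite -subr_eq0; apply/eqP.
  have [pN pK] := pP x; apply: NK; first by rewrite submod_subr_closed.
  have -> : p x - z = (x - z) - (x - p x) by rewrite opprB [RHS]addrC addrA subrK.
  by rewrite submod_subr_closed.
have [q qE] : exists q : {linear M -> M}, q =1 p.
  apply: linear_pack => a x z; have [xN xK] := pP x; have [zN zK] := pP z.
  apply: p_uniq; first by rewrite rpredD // rpredZ.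
  by rewrite opprD addrACA -scalerN -scalerDr rpredD // rpredZ.
have [|r rE] := @corestrict R M M N q.
  by move=> x; rewrite qE; have [] := pP x.
move/eqP: y0; apply.
have y0 : Sub y yN = 0 :> submod N.
  apply: projective_cogenerated projN _ => f.
  have -> : Sub y yN = r y :> submod N; last exact: (hom0 (f \o r)).
  by apply: val_inj; rewrite rE SubK qE; apply/esym/p_uniq; rewrite ?subrr ?rpred0.
by rewrite -(SubK (submod N) yN) y0 linear0.
Qed.

(** On the image of the section [s], [f] is injective; if that image were nonzero it would contain a
    nonzero element of [S], which [f] kills. *)
Lemma vanish_on_essential (B : lmodType R) (S : B -> Prop)
    (f : {linear B -> R^o}) :
  (forall N : submodClosed B, nonzero_submod N ->
     exists x, [/\ S x, x \in N & x != 0]) ->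
  (forall x, S x -> f x = 0) -> forall x, f x = 0.
Proof.
move=> essS f0 x; have [J [s [fJ sK]]] := image_splits f.
have [||N NP] := @submod_pack R B (fun x => exists y, s y = x).
- by exists 0; rewrite linear0.
- by move=> a _ _ [y <-] [z <-]; exists (a *: y + z); rewrite linearP.
apply: contrapT => fx0; have [|z [Sz /NP[y yz] z0]] := essS N.
  pose y : submod J := Sub (f x) (fJ x).
  exists (s y); first by apply/NP; exists y.
  by apply/eqP => sy0; apply: fx0; rewrite -(SubK (submod J) (fJ x)) -sK sy0 linear0.
have y0 : y = 0 by apply: val_inj; rewrite -sK yz f0 // linear0.
by move/eqP: z0; apply; rewrite -yz y0 linear0.
Qed.

End Hereditary.

(** * The largest stable submodule as a common kernel, and its injectivity *)

Section QF3plus.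
Variable R : pzRingType.
Hypotheses (hered : left_hereditary R) (qf3 : left_QF3plus R).

(* Maps to [R] defined on a submodule need not extend to [M]; they do after
   enlarging the target to [E(R)], which [R] cogenerates. *)
Lemma vanish_extension (N M : lmodType R) (i : {linear N -> M}) (x : N) :
  injective i -> (forall f : {linear M -> R^o}, f (i x) = 0) ->
  forall f : {linear N -> R^o}, f x = 0.
Proof.
move=> inj_i f0 f; have [E [e [[injE [inj_e _]] projE]]] := qf3.
have [h hE] := injE _ _ i (e \o f) inj_i.
apply: inj_e; rewrite linear0 -[LHS]hE.
apply: projective_cogenerated projE _ => g; exact: (f0 (g \o h)).
Qed.

Lemma mem_stable_part (M : lmodType R) (x : M) :
  x \in stable_part M <-> forall f : {linear M -> R^o}, f x = 0.
Proof.
have [||N NP] := @submod_pack R M (fun x => forall f : {linear M -> R^o}, f x = 0).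
- by move=> f; rewrite linear0.
- by move=> a y z fy fz f; rewrite linearP fy fz scaler0 addr0.
(* Maps on [N] vanish since all maps on [M] vanish there; conversely, maps on [M] restrict to zero
   on any stable submodule. *)
have largeN : largest_stable_submod N.
  split=> [|N' /(stableP hered) stN' y yN'].
    apply/(stableP hered) => f y; apply: (@vanish_extension _ _ val).
      exact: val_inj.
    by apply/NP; exact: valP.
  by apply/NP => f; have := stN' (f \o val) (Sub y yN').
rewrite -NP /stable_part; case: pselect => [ex|[]]; last by exists N.
case: (cid ex) => N' [stN' maxN'] /=; split; first exact: largeN.2.
exact: maxN' largeN.1 x.
Qed.

Lemma stable_part_injective (I : lmodType R) :
  injective_module I -> injective_module (submod (stable_part I)).
Proof.
move=> injI A B g f inj_g.
have [||gA gAP] := @submod_pack R B (fun x => exists a, g a = x).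
- by exists 0; rewrite linear0.
- by move=> a _ _ [y <-] [z <-]; exists (a *: y + z); rewrite linearP.
have [K [AK essAK]] := complement_exists gA.
(* [u] embeds the direct sum of [A] and [K] onto an essential submodule of [B]; [v] below is [f]
   extended by zero on [K]. *)
have [u uE] : exists u : {linear (A * submod K)%type -> B},
    forall z, u z = g z.1 + \val z.2.
  by apply: linear_pack => a y z; rewrite !linearP /= scalerDr addrACA.
have [v vE] : exists v : {linear (A * submod K)%type -> I},
    forall z, v z = \val (f z.1).
  by apply: linear_pack => a y z; rewrite !linearP.
have u_inj : injective u.
  move=> y z yz; apply/eqP; rewrite -subr_eq0; apply/eqP.
  have : u (y - z) = 0 by rewrite linearB yz subrr.
  case: (y - z) => a k; rewrite uE /= => /eqP; rewrite addr_eq0 => /eqP gak.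
  have ga0 : g a = 0.
    apply: AK; first by apply/gAP; exists a.
    by rewrite gak; apply: submod_oppr_closed; exact: valP.
  have -> : a = 0 by apply: inj_g; rewrite ga0 linear0.
  congr pair; apply: val_inj; rewrite linear0.
  by apply: oppr_inj; rewrite -gak ga0 oppr0.
have [h hE] := injI _ _ u v u_inj.
have hS x : h x \in stable_part I.
  apply/mem_stable_part => phi.
  apply: (@vanish_on_essential R hered B (fun z => exists w, u w = z) (phi \o h)).
    move=> N /essAK [_ [k [/gAP[a <-] kK akN ak0]]].
    exists (g a + k); split=> //.
    by exists (a, Sub k kK); rewrite uE.
  move=> _ [w <-] /=; rewrite hE vE; move: phi; apply/mem_stable_part.
  exact: valP.
have [h' h'E] := corestrict hS.
exists h' => a; apply: val_inj; rewrite h'E.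
have := hE (a, 0); rewrite uE vE /= => <-.
by rewrite addr0.
Qed.

End QF3plus.

Theorem corollary3p5 (R : pzRingType)
    (hered : left_hereditary R) (qf3 : left_QF3plus R) :
  (forall (M E : lmodType R) (i : {linear M -> E}),
     injective_envelope i ->
     exists j : {linear submod (stable_part M) -> submod (stable_part E)},
       (forall x : submod (stable_part M), \val (j x) = i (\val x)) /\
       injective_envelope j) /\
  (forall I : lmodType R,
     injective_module I -> injective_module (submod (stable_part I))).
Proof.
split=> [M E i [injE [inj_i ess_i]]|]; last exact: stable_part_injective.
have [|j jE] := @corestrict R _ _ (stable_part E)
    (i \o (val : {linear submod (stable_part M) -> M})).
  move=> x; apply/(mem_stable_part hered qf3) => f /=.
  have /(mem_stable_part hered qf3) x0 : \val x \in stable_part M by exact: valP.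
  exact: (x0 (f \o i)).
exists j; split=> //; split; first exact: stable_part_injective.
split=> [x y xy|N [n nN n0]].
  by apply/val_inj/inj_i; rewrite -[LHS]jE xy jE.
(* [N'] is [N] viewed inside [E], where essentiality of [i] applies. *)
have [||N' N'P] := @submod_pack R E
    (fun x => exists2 y : submod (stable_part E), y \in N & \val y = x).
- by exists 0; rewrite ?rpred0 ?linear0.
- move=> a _ _ [y yN <-] [z zN <-].
  by exists (a *: y + z); rewrite ?linearP // rpredD // rpredZ.
have [|x x0 /N'P[y yN yx]] := ess_i N'.
  exists (\val n); first by apply/N'P; exists n.
  by apply: contraNneq n0 => n0; apply/eqP; apply: val_inj; rewrite n0 linear0.
(* All maps from [E] to [R] kill [i x], hence all maps from [M] to [R] kill [x]. *)
have xM : x \in stable_part M.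
  apply/(mem_stable_part hered qf3); apply: (vanish_extension qf3 inj_i).
  by apply/(mem_stable_part hered qf3); rewrite -yx; exact: valP.
exists (Sub x xM).
  by apply: contraNneq x0 => /(congr1 val); rewrite SubK linear0 => ->.
suff -> : j (Sub x xM) = y by [].
by apply: val_inj; rewrite jE yx.
Qed.
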